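(* Let $\omega$ be a Weierstrass representation of a Riemann surface $M$, and let $(S,u,v)$ be the corresponding spinor representation. Then the periods of $\omega$ are purely imaginary if and only if $u^2$ and $v^2$ have conjugate periods and $uv$ has purely imaginary periods; that is, $\int_\gamma\omega\in i\mathbb{R}^3$ for every piecewise smooth loop $\gamma$ in $M$ if and only if $\overline{\int_\gamma u^2}=\int_\gamma v^2$ and $\int_\gamma uv\in i\mathbb{R}$ for every piecewise smooth loop $\gamma$ in $M$.
   Context: A Weierstrass representation of $M$ is a nowhere vanishing smooth $\mathbb{C}^3$-valued $(1,0)$-form $\omega=(\omega_1,\omega_2,\omega_3)$ on $M$ with $\omega_1^2+\omega_2^2+\omega_3^2=0$. Periods of a form are its integrals over piecewise smooth loops in $M$. A square root of $TM$ is a smooth complex line bundle $S$ over $M$ with a smooth surjective bundle map $S\to TM$, $s\mapsto s^2$, over $M$, complex-quadratic on each fiber. $S^{*1,0}$ is the complex dual of $S$. For sections $\xi,\xi'$ of $S^{*1,0}$, $\xi\xi'$ is the $(1,0)$-form on $M$ defined by $(\xi\xi')(s^2)=\xi(s)\xi'(s)$ for $s\in S$, and $\xi^2=\xi\xi$. The spinor representation corresponding to $\omega$: let $\theta(z_0,z_1)=(z_0^2-z_1^2,i(z_0^2+z_1^2),2z_0z_1)$, a map from $\mathbb{C}^2$ onto $Q=\{w\in\mathbb{C}^3:w_1^2+w_2^2+w_3^2=0\}$, inducing a biholomorphism $\mathbb{C}P^1\cong[Q]$ onto the projectivization of $Q$; let $\eta\colon M\to\mathbb{C}P^1\cong[Q]$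 be $\eta(p)=\omega(T_pM)$. Then $S=\eta^*\mathcal{O}_{\mathbb{C}P^1}(-1)$ (pullback of the tautological bundle), with the quadratic map $S\to TM$ sending $s\in S_p\subset\mathbb{C}^2$ to the unique $s^2\in T_pM$ with $\omega(s^2)=\theta(s)$, and $u,v$ are the sections of $S^{*1,0}$ given by the two coordinates of $S_p\subset\mathbb{C}^2$. *)

(* Defs.v *)
From HB Require Import structures.
From mathcomp Require Import all_boot all_order all_algebra.
From mathcomp Require Import all_classical all_reals all_analysis.
From mathcomp Require Import complex.

Set Implicit Arguments.
Unset Strict Implicit.
Unset Printing Implicit Defensive.

Import Order.TTheory GRing.Theory Num.Theory.
Import numFieldNormedType.Exports.

Local Open Scope classical_set_scope.
Local Open Scope ring_scope.

(* The ascription gives the carrier R[i] the topology and the normed space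
   structure over itself that MathComp-Analysis attaches to any numFieldType,
   so that [derivable f z 1] is complex differentiability. *)
Definition Cplx (R : realType) : numClosedFieldType := R[i].

Definition imagU (R : realType) : Cplx R := Complex 0 1.
Definition ofReal (R : realType) (x : R) : Cplx R := Complex x 0.
Definition cRe (R : realType) (z : Cplx R) : R := complex.Re z.
Definition cIm (R : realType) (z : Cplx R) : R := complex.Im z.

(* Derivative of a curve in C, viewed as R^2. *)
Definition curve_deriv (R : realType) (c : R -> Cplx R) (t : R) : Cplx R :=
  Complex (derive1 (@cRe R \o c) t) (derive1 (@cIm R \o c) t).

Definition partial (R : realType) (v : Cplx R) (f : Cplx R -> R) (z : Cplx R) : R :=
  derive1 (fun t : R => f (z + ofReal t * v)) 0.

Definition has_partial (R : realType) (v : Cplx R) (f : Cplx R -> R) (z : Cplx R) :=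
  derivable (fun t : R => f (z + ofReal t * v)) 0 1.

(* f is of class C^n, in the sense of R^2, on the open set U. *)
Fixpoint classC (R : realType) (n : nat) (U : set (Cplx R)) (f : Cplx R -> R) : Prop :=
  if n is m.+1 then
    [/\ forall z, U z -> has_partial 1 f z /\ has_partial (imagU R) f z,
        classC m U (partial 1 f) & classC m U (partial (imagU R) f)]
  else forall z, U z -> {for z, continuous f}.

Definition smooth_on (R : realType) (U : set (Cplx R)) (f : Cplx R -> Cplx R) :=
  forall n, classC n U (@cRe R \o f) /\ classC n U (@cIm R \o f).

(* Second countability is automatic (Rado).  The functions [rs_phi i] and
   [rs_psi i] are only meaningful on [rs_dom i] and on its image. *)
Record riemannSurface (R : realType) := RiemannSurface {
  rs_carrier :> topologicalType;
  rs_hausdorff : hausdorff_space rs_carrier;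
  rs_connected : connected [set: rs_carrier];
  rs_nonempty : [set: rs_carrier] !=set0;
  rs_index : Type;
  rs_dom : rs_index -> set rs_carrier;
  rs_phi : rs_index -> rs_carrier -> Cplx R;
  rs_psi : rs_index -> Cplx R -> rs_carrier;
  rs_dom_open : forall i, open (rs_dom i);
  rs_cover : forall p, exists i, rs_dom i p;
  rs_img_open : forall i, open (rs_phi i @` rs_dom i);
  rs_phiK : forall i p, rs_dom i p -> rs_psi i (rs_phi i p) = p;
  rs_phi_cont : forall i p, rs_dom i p -> {for p, continuous (rs_phi i)};
  rs_psi_cont : forall i z, (rs_phi i @` rs_dom i) z ->
    {for z, continuous (rs_psi i)};
  rs_holo : forall i j z, (rs_phi i @` (rs_dom i `&` rs_dom j)) z ->
    derivable (rs_phi j \o rs_psi i : Cplx R -> Cplx R) z 1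
}.

(* The complex derivative at p of the transition map from chart i to chart j. *)
Definition trans_deriv (R : realType) (M : riemannSurface R)
    (i j : rs_index M) (p : M) : Cplx R :=
  derive1 (@rs_phi R M j \o @rs_psi R M i : Cplx R -> Cplx R) (rs_phi i p).

(* A tangent vector at p is its family of coordinates in all the charts around
   p, transforming by the derivatives of the transition maps; the entries at the
   charts not containing p are set to 0. *)
Definition tangent_pred (R : realType) (M : riemannSurface R) (p : M) :
    {pred (rs_index M -> Cplx R)} :=
  fun X => `[< (forall i, ~ rs_dom i p -> X i = 0) /\
     (forall i j, rs_dom i p -> rs_dom j p -> X j = trans_deriv i j p * X i) >].

Lemma tangent_submod_closed (R : realType) (M : riemannSurface R) (p : M) :
  submod_closed (@tangent_pred R M p).
Proof.
split=> [|a X Y /asboolP[X0 XE] /asboolP[Y0 YE]]; apply/asboolP.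
  by split=> [//|i j _ _]; rewrite mulr0.
split=> [i ip|i j ip jp] /=.
  by rewrite /GRing.add /GRing.scale /= (X0 _ ip) (Y0 _ ip) scaler0 addr0.
by rewrite /GRing.add /GRing.scale /= (XE _ _ ip jp) (YE _ _ ip jp) mulrDr scalerAr.
Qed.

HB.instance Definition _ (R : realType) (M : riemannSurface R) (p : M) :=
  GRing.isSubmodClosed.Build (Cplx R) (rs_index M -> Cplx R) (@tangent_pred R M p)
    (tangent_submod_closed p).

Record tangent (R : realType) (M : riemannSurface R) (p : M) := Tangent {
  tcoord :> rs_index M -> Cplx R;
  tcoordP : tcoord \in @tangent_pred R M p
}.

HB.instance Definition _ (R : realType) (M : riemannSurface R) (p : M) :=
  [isSub for @tcoord R M p].
HB.instance Definition _ (R : realType) (M : riemannSurface R) (p : M) :=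
  [Choice of tangent p by <:].
HB.instance Definition _ (R : realType) (M : riemannSurface R) (p : M) :=
  [SubChoice_isSubLmodule of tangent p by <:].

(* Not necessarily smooth.  The tangent space T_pM is a complex line, and a
   (1,0)-covector at p is a complex-linear functional on it. *)
Definition form10 (R : realType) (M : riemannSurface R) :=
  forall p : M, {linear tangent p -> (Cplx R)^o}.

Definition form0 (R : realType) (M : riemannSurface R) : form10 M :=
  fun p => \0.

(* In each chart z, alpha = f dz with f smooth (in the real sense). *)
Definition smooth_form (R : realType) (M : riemannSurface R) (alpha : form10 M) :=
  forall i : rs_index M, exists2 f : Cplx R -> Cplx R,
    smooth_on (rs_phi i @` rs_dom i) f &
    forall (p : M) (X : tangent p), rs_dom i p -> alpha p X = f (rs_phi i p) * X i.

Definition smooth_curve (R : realType) (M : riemannSurface R) (D : set R) (c : R -> M) :=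
  forall t, D t -> {for t, continuous c} /\
    forall (i : rs_index M) (n : nat), rs_dom i (c t) ->
      derivable (derive1n n (@cRe R \o rs_phi i \o c)) t 1 /\
      derivable (derive1n n (@cIm R \o rs_phi i \o c)) t 1.

(* c is smooth on [a, b] up to the end points: it extends to a smooth curve on
   an open interval containing [a, b]. *)
Definition smooth_arc (R : realType) (M : riemannSurface R) (a b : R) (c : R -> M) :=
  exists (h : R -> M) (e : R), [/\ 0 < e,
    smooth_curve [set` `]a - e, b + e[] h & {in `[a, b], h =1 c}].

Record pw_smooth_loop (R : realType) (M : riemannSurface R) := PwSmoothLoop {
  loop_path :> R -> M;
  loop_cont : {within `[0, 1], continuous loop_path};
  loop_closed : loop_path 0 = loop_path 1;
  loop_pieces : exists s : seq R,
    [/\ path <%R 0 s, last 0 s = 1 &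
     forall k, (k < size s)%N -> smooth_arc (nth 0 (0 :: s) k) (nth 0 s k) loop_path]
}.

(* The velocity vector c'(t); it is 0 by convention if c has no velocity at t. *)
Definition velocity (R : realType) (M : riemannSurface R) (c : R -> M) (t : R) :
    tangent (c t) :=
  xget 0 [set X : tangent (c t) | forall i, rs_dom i (c t) ->
            X i = curve_deriv (rs_phi i \o c) t].

(* The velocity is only unspecified at the finitely many break points, which do
   not affect the integral. *)
Definition period (R : realType) (M : riemannSurface R) (c : pw_smooth_loop M)
    (alpha : form10 M) : Cplx R :=
  Complex
    (\int[lebesgue_measure]_(t in `[0, 1]) cRe (alpha (c t) (velocity c t)))
    (\int[lebesgue_measure]_(t in `[0, 1]) cIm (alpha (c t) (velocity c t))).

Definition weval (R : realType) (M : riemannSurface R) (w : 'I_3 -> form10 M)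
    (p : M) (X : tangent p) : 'rV[Cplx R]_3 := \row_k w k p X.

Record weierstrass (R : realType) (M : riemannSurface R) := Weierstrass {
  wform :> 'I_3 -> form10 M;
  wform_smooth : forall k, smooth_form (wform k);
  wform_nowhere0 : forall p, exists X : tangent p, weval wform X != 0;
  wform_null : forall p (X : tangent p), \sum_k wform k p X ^+ 2 = 0
}.

Definition theta (R : realType) (s : 'rV[Cplx R]_2) : 'rV[Cplx R]_3 :=
  let z0 := s 0 0 in let z1 := s 0 1 in
  \row_(k < 3) [:: z0 ^+ 2 - z1 ^+ 2; imagU R * (z0 ^+ 2 + z1 ^+ 2); 2 * z0 * z1]`_k.

(* CP^n, as the set of lines of C^(n+1). *)
Definition CP (R : realType) (n : nat) :=
  {l : {vspace 'rV[Cplx R]_n.+1} | \dim l == 1%N}.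

Lemma CP0_subproof (R : realType) (n : nat) :
  \dim <[(delta_mx 0 0 : 'rV[Cplx R]_n.+1)%R]>%VS == 1%N.
Proof.
have e0 : (delta_mx 0 0 : 'rV[Cplx R]_n.+1) != 0.
  by apply/eqP => /matrixP/(_ 0 0)/eqP; rewrite !mxE !eqxx oner_eq0.
by rewrite dim_vline e0.
Qed.

Definition CP0 (R : realType) (n : nat) : CP R n :=
  exist (fun l : {vspace 'rV[Cplx R]_n.+1} => \dim l == 1%N) _ (CP0_subproof R n).

(* eta(p) is the line of C^2 corresponding to the line omega(T_pM) of Q under
   the bijection l |-> theta(l) between CP^1 and [Q]. *)
Definition eta (R : realType) (M : riemannSurface R) (w : weierstrass M) (p : M) :
    CP R 1 :=
  xget (CP0 R 1) [set l : CP R 1 |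
    @theta R @` [set s | s \in val l] = range (@weval R M w p)].

(* The fiber at p of the pullback by eta of the tautological bundle. *)
Definition Sfiber (R : realType) (M : riemannSurface R) (w : weierstrass M) (p : M) :=
  subvs_of (val (eta w p)).

(* The squaring map S -> TM: s^2 is the unique tangent vector with
   omega(s^2) = theta(s). *)
Definition Ssq (R : realType) (M : riemannSurface R) (w : weierstrass M) (p : M)
    (s : Sfiber w p) : tangent p :=
  xget 0 [set X : tangent p | weval w X = theta (vsval s)].

Definition Sdual_section (R : realType) (M : riemannSurface R) (w : weierstrass M) :=
  forall p : M, {linear Sfiber w p -> (Cplx R)^o}.

Definition Scoord (R : realType) (M : riemannSurface R) (w : weierstrass M)
    (k : 'I_2) (p : M) (s : Sfiber w p) : (Cplx R)^o := vsval s 0 k.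

Lemma Scoord_is_linear (R : realType) (M : riemannSurface R) (w : weierstrass M)
  (k : 'I_2) (p : M) : linear (@Scoord R M w k p).
Proof. by move=> a s t; rewrite /Scoord linearP !mxE. Qed.

HB.instance Definition _ (R : realType) (M : riemannSurface R) (w : weierstrass M)
    (k : 'I_2) (p : M) :=
  GRing.isLinear.Build (Cplx R) (Sfiber w p) (Cplx R)^o *:%R (@Scoord R M w k p)
    (@Scoord_is_linear R M w k p).

Definition spinor_u (R : realType) (M : riemannSurface R) (w : weierstrass M) :
  Sdual_section w := fun p => @Scoord R M w 0 p.
Definition spinor_v (R : realType) (M : riemannSurface R) (w : weierstrass M) :
  Sdual_section w := fun p => @Scoord R M w 1 p.

(* The unique such form; it exists because s |-> s^2 is onto T_pM and identifies
   exactly s with -s. *)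
Definition spinor_prod (R : realType) (M : riemannSurface R) (w : weierstrass M)
    (xi xi' : Sdual_section w) : form10 M :=
  xget (@form0 R M) [set alpha : form10 M |
    forall p (s : Sfiber w p), alpha p (Ssq s) = xi p s * xi' p s].

Definition purely_imaginary (R : realType) (z : Cplx R) :=
  exists y : R, z = imagU R * ofReal y.

(* Main.v *)
(** Since omega = theta(u, v), the identities u^2 = (omega_1 - i omega_2) / 2,
    v^2 = - (omega_1 + i omega_2) / 2 and uv = omega_3 / 2 hold pointwise, so with
    P_k the period of omega_k the conditions on u^2, v^2 and uv amount to
    Re P_1 = Re P_2 = Re P_3 = 0.  Passing from forms to periods uses linearity of
    the Lebesgue integral, hence the integrability of omega_k along a loop: on each
    piece omega_k(c') agrees off the end points with a continuous function, because
    by the chain rule the chart velocities of c form a tangent vector. *)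
Require Import Defs.
From mathcomp Require Import all_boot all_order all_algebra.
From mathcomp Require Import all_classical all_reals all_analysis.
From mathcomp Require Import complex.
From mathcomp Require Import ring lra.

Set Implicit Arguments.
Unset Strict Implicit.
Unset Printing Implicit Defensive.

Import Order.TTheory GRing.Theory Num.Theory.
Import numFieldNormedType.Exports.

Local Open Scope classical_set_scope.
Local Open Scope ring_scope.

(** * Tangent lines and the quadric Q *)

Lemma imagU_sqr (R : realType) : imagU R * imagU R = -1.
Proof. by apply/eqP; rewrite /imagU eq_complex /= !mul0r !mul1r sub0r addr0 oppr0 !eqxx. Qed.

(** The transition rule recovers every entry at a chart around p from the one at i, and the entries
    at all other charts are 0. *)
Lemma tangent_eq (R : realType) (M : riemannSurface R) (p : M) (i : rs_index M)
  (X Y : tangent p) : rs_dom i p -> X i = Y i -> X = Y.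
Proof.
move=> ip XY; apply: val_inj; apply/funext => j /=.
have /asboolP[X0 XE] := tcoordP X; have /asboolP[Y0 YE] := tcoordP Y.
have [jp|jp] := pselect (rs_dom j p); last by rewrite X0 ?Y0.
by rewrite (XE _ _ ip jp) (YE _ _ ip jp) XY.
Qed.

Lemma tangent_line (R : realType) (M : riemannSurface R) (p : M)
  (X0 X : tangent p) : X0 != 0 -> exists a : Cplx R, X = a *: X0.
Proof.
move=> X0n; have [i ip] := rs_cover p.
have X0i : X0 i != 0.
  by apply: contra_neq X0n => X0i; apply: (tangent_eq ip); rewrite X0i.
by exists (X i / X0 i); apply: (tangent_eq ip); rewrite -[RHS]/(X i / X0 i * X0 i) mulfVK.
Qed.

Lemma wevalB (R : realType) (M : riemannSurface R) (w : 'I_3 -> form10 M) (p : M)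
  (X Y : tangent p) : weval w (X - Y) = weval w X - weval w Y.
Proof. by apply/rowP => k; rewrite !mxE linearB. Qed.

Lemma wevalZ (R : realType) (M : riemannSurface R) (w : 'I_3 -> form10 M) (p : M)
  (a : Cplx R) (X : tangent p) : weval w (a *: X) = a *: weval w X.
Proof. by apply/rowP => k; rewrite !mxE linearZ. Qed.

Lemma thetaZ (R : realType) (a : Cplx R) (s : 'rV[Cplx R]_2) :
  theta (a *: s) = a ^+ 2 *: theta s.
Proof. by apply/rowP => -[[|[|[|//]]] ?]; rewrite !mxE /=; ring. Qed.

(** T_pM is a complex line on which omega does not vanish: X - Y is a multiple of a vector with
    nonzero image, so the factor is 0. This is the uniqueness of s^2 in [Ssq]. *)
Lemma weval_inj (R : realType) (M : riemannSurface R) (w : weierstrass M) (p : M) :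
  injective (@weval R M w p).
Proof.
have [X0 wX0] := wform_nowhere0 w p.
have X0n : X0 != 0.
  by apply: contra_neq wX0 => ->; rewrite -[0](scale0r 0) wevalZ scale0r.
move=> X Y /eqP; rewrite -subr_eq0 -wevalB => /eqP wXY; apply/eqP.
rewrite -subr_eq0; have [a aE] := tangent_line (X - Y) X0n.
move: wXY; rewrite aE wevalZ => /eqP; rewrite scaler_eq0 (negbTE wX0) orbF.
by move=> /eqP ->; rewrite scale0r.
Qed.

Lemma sum3 (V : nmodType) (F : 'I_3 -> V) : \sum_k F k = F 0 + (F 1 + F 2).
Proof.
rewrite !big_ord_recl big_ord0 addr0; congr (_ + (F _ + F _)); exact: val_inj.
Qed.

Lemma theta_onto (R : realType) (q : 'rV[Cplx R]_3) :
  \sum_k q 0 k ^+ 2 = 0 -> exists s, theta s = q.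
Proof.
rewrite sum3; set a := q 0 0; set b := q 0 1; set c := q 0 2 => abc.
have I2 := imagU_sqr R; set I := imagU R in I2 *.
(* Solving z0^2 - z1^2 = a and i (z0^2 + z1^2) = b for the two squares gives these values; the signs
   of the roots remain to be matched with c. *)
pose z0 := sqrtC ((a - I * b) / 2); pose z1 := sqrtC (- (a + I * b) / 2).
have z0E : z0 ^+ 2 = (a - I * b) / 2 by exact: sqrtCK.
have z1E : z1 ^+ 2 = - (a + I * b) / 2 by exact: sqrtCK.
suff [y [yE zyE]] : exists y, y ^+ 2 = - (a + I * b) / 2 /\ 2 * z0 * y = c.
  exists (\row_k [:: z0; y]`_k); apply/rowP => k.
  have : k \in [:: 0; 1; 2] by case: k => -[|[|[|]]].
  rewrite !inE => /or3P[] /eqP ->; rewrite !mxE /=; last by [].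
  - by rewrite z0E yE -/a; field.
  - by rewrite z0E yE -/b mulrDr -/I; transitivity (- (I * I) * b); [field|rewrite I2; ring].
(* As a^2 + b^2 + c^2 = 0, the product 2 z0 z1 is c or -c; in the second case z1 is replaced by its
   opposite. *)
have : (2 * z0 * z1) ^+ 2 = c ^+ 2.
  rewrite !exprMn z0E z1E; transitivity (- (a ^+ 2 - I * I * b ^+ 2)); first by field.
  have -> : c ^+ 2 = - (a ^+ 2 + b ^+ 2).
    by apply/eqP; rewrite -addr_eq0 addrC -addrA abc.
  by rewrite I2; ring.
move=> /eqP; rewrite eqf_sqr => /orP[] /eqP zz; first by exists z1.
by exists (- z1); rewrite sqrrN mulrN zz opprK.
Qed.

(** * The fibers of S and the squaring map *)

(** The [xget] in [eta] has a witness: the line spanned by a preimage s of omega(X0) under theta.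
    Since theta(a s) = a^2 omega(X0) and every complex number is a square, theta maps this line onto
    all of omega(T_pM). *)
Lemma etaP (R : realType) (M : riemannSurface R) (w : weierstrass M) (p : M) :
  @theta R @` [set s | s \in val (Defs.eta w p)] = range (@weval R M w p).
Proof.
rewrite /Defs.eta; apply: (@xgetPex _ _ [set l : CP R 1 |
    @theta R @` [set s | s \in val l] = range (@weval R M w p)]).
have [X0 wX0] := wform_nowhere0 w p.
have X0n : X0 != 0.
  by apply: contra_neq wX0 => ->; rewrite -[0](scale0r 0) wevalZ scale0r.
have [s sE] : exists s, theta s = weval w X0.
  by apply: theta_onto; under eq_bigr do rewrite mxE; exact: wform_null.
have s0 : s != 0.
  by apply: contra_neq wX0 => s0; rewrite -sE s0 -[0](scale0r 0) thetaZ expr0n scale0r.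
have ds : \dim <[s]>%VS == 1%N by rewrite dim_vline s0.
exists (exist (fun l : {vspace 'rV[Cplx R]_2} => \dim l == 1%N) _ ds); apply/seteqP; split => /= q.
  move=> [t /vlineP[a ->] <-]; exists (a ^+ 2 *: X0) => //.
  by rewrite wevalZ thetaZ sE.
move=> [X _ <-]; have [a ->] := tangent_line X X0n.
exists (sqrtC a *: s); first exact: memvZ (memv_line _).
by rewrite thetaZ sqrtCK sE wevalZ.
Qed.

Lemma SsqP (R : realType) (M : riemannSurface R) (w : weierstrass M) (p : M)
  (s : Sfiber w p) : weval w (Ssq s) = theta (vsval s).
Proof.
apply: (@xgetPex _ _ [set X : tangent p | weval w X = theta (vsval s)]) => /=.
have : range (@weval R M w p) (theta (vsval s)).
  by rewrite -etaP; exists (vsval s) => //=; exact: subvsP.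
by case=> X _ XE; exists X.
Qed.

(** By the choice of eta, omega(X) is theta(s) for some s in the fiber, and injectivity of omega
    then identifies s^2 with X. *)
Lemma Ssq_onto (R : realType) (M : riemannSurface R) (w : weierstrass M) (p : M)
  (X : tangent p) : exists s : Sfiber w p, Ssq s = X.
Proof.
have : (@theta R @` [set s | s \in val (Defs.eta w p)]) (weval w X) by rewrite etaP; exists X.
case=> s /= sl sE; exists (Subvs sl).
by apply: (@weval_inj _ _ w); rewrite SsqP.
Qed.

(** * The forms u^2, v^2 and uv in terms of omega *)

(** The form alpha shows that the [xget] in [spinor_prod] does not take its default value; the two
    forms then agree on squares, and every tangent vector is a square. *)
Lemma spinor_prodE (R : realType) (M : riemannSurface R) (w : weierstrass M)
    (xi xi' : Sdual_section w) (alpha : form10 M) :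
    (forall p (s : Sfiber w p), alpha p (Ssq s) = xi p s * xi' p s) ->
  forall p (X : tangent p), spinor_prod xi xi' p X = alpha p X.
Proof.
move=> alphaE p X; have [s <-] := Ssq_onto w X; rewrite alphaE.
by apply: (@xgetPex _ _ [set alpha : form10 M |
    forall p (s : Sfiber w p), alpha p (Ssq s) = xi p s * xi' p s]); exists alpha.
Qed.

Lemma wform_Ssq (R : realType) (M : riemannSurface R) (w : weierstrass M) (p : M)
    (s : Sfiber w p) (k : 'I_3) : w k p (Ssq s) = theta (vsval s) 0 k.
Proof. by rewrite -SsqP mxE. Qed.

Lemma spinor_uuE (R : realType) (M : riemannSurface R) (w : weierstrass M) (p : M)
    (X : tangent p) : spinor_prod (spinor_u w) (spinor_u w) p X
  = 2^-1 * (w 0 p X - imagU R * w 1 p X).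
Proof.
(* Assembled from linear maps, the candidate is itself a (1,0)-form; on squares the claim is z0^2 =
   (theta_1 - i theta_2) / 2. *)
pose alpha : form10 M := fun p =>
  (2^-1 : Cplx R) \*: (w 0 p \- imagU R \*: w 1 p).
rewrite (@spinor_prodE _ _ _ _ _ alpha) // => q s.
rewrite /alpha /= !wform_Ssq !mxE /= /spinor_u /= /Scoord /GRing.scale /= mulrA imagU_sqr.
by field.
Qed.

Lemma spinor_vvE (R : realType) (M : riemannSurface R) (w : weierstrass M) (p : M)
    (X : tangent p) : spinor_prod (spinor_v w) (spinor_v w) p X
  = - 2^-1 * (w 0 p X + imagU R * w 1 p X).
Proof.
pose alpha : form10 M := fun p =>
  (- 2^-1 : Cplx R) \*: (w 0 p \+ imagU R \*: w 1 p).
rewrite (@spinor_prodE _ _ _ _ _ alpha) // => q s.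
rewrite /alpha /= !wform_Ssq !mxE /= /spinor_v /= /Scoord /GRing.scale /= mulrA imagU_sqr.
by field.
Qed.

Lemma spinor_uvE (R : realType) (M : riemannSurface R) (w : weierstrass M) (p : M)
    (X : tangent p) : spinor_prod (spinor_u w) (spinor_v w) p X
  = 2^-1 * w 2 p X.
Proof.
pose alpha : form10 M := fun p => (2^-1 : Cplx R) \*: w 2 p.
rewrite (@spinor_prodE _ _ _ _ _ alpha) // => q s.
rewrite /alpha /= !wform_Ssq !mxE /= /spinor_u /spinor_v /= /Scoord /GRing.scale /=.
by field.
Qed.

(** * Differential calculus of curves in C *)

Lemma cRe_continuous (R : realType) : continuous (@cRe R).
Proof.
move=> z; apply/(@cvgrPdist_lt _ _ _ (nbhs z) (nbhs_filter (z : Cplx R))) => e e0.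
(* The norm of [Cplx R] takes its values in [Cplx R], so the radius has to be a complex number. *)
exists (ofReal e); first by rewrite /= ltcR.
move=> y /= /(le_lt_trans (normc_ge_Re _)); rewrite ltcR.
by rewrite /cRe raddfB.
Qed.

Lemma cImE (R : realType) (z : Cplx R) : cIm z = cRe (- imagU R * z).
Proof. by case: z => a b; rewrite /cIm /cRe /= oppr0 mul0r mulN1r sub0r opprK. Qed.

Lemma cIm_continuous (R : realType) : continuous (@cIm R).
Proof.
rewrite (_ : @cIm R = @cRe R \o *%R (- imagU R)); last first.
  by apply/funext => z; exact: cImE.
by move=> z; apply: continuous_comp; [exact: mulrl_continuous|exact: cRe_continuous].
Qed.

(** Caratheodory's form of differentiability: the difference quotient, completed at z by the
    derivative, is continuous there. It reduces the chain rule to algebra on slopes. *)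
Lemma derivable_slope (K : numFieldType) (F : K -> K) (z : K) : derivable F z 1 ->
  exists Q : K -> K, [/\ {for z, continuous Q}, Q z = derive1 F z &
    forall y, F y - F z = Q y * (y - z)].
Proof.
move=> dF; pose Q y := if y == z then derive1 F z else (y - z)^-1 * (F y - F z).
have Qz : Q z = derive1 F z by rewrite /Q eqxx.
exists Q; split=> // [|y]; last first.
  rewrite /Q; case: eqP => [->|/eqP yz]; first by rewrite !subrr mulr0.
  by rewrite mulrAC mulVf ?subr_eq0// mul1r.
apply/(@cvgrPdist_lt _ _ _ (nbhs z) (nbhs_filter (z : K))) => e e0; rewrite Qz.
have FL : h^-1 *: (F (h *: 1 + z) - F z) @[h --> 0^'] --> derive1 F z.
  by rewrite derive1E; exact: dF.
have {FL} : \forall h \near (0 : K), h != 0 ->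
    `|derive1 F z - h^-1 *: (F (h *: 1 + z) - F z)| < e.
  by have /cvgrPdist_lt/(_ e e0) := FL.
have yz0 : (fun y : K => y - z) @ z --> (0 : K).
  by rewrite -[X in _ --> X](subrr z); apply: (@cvgB K K K (nbhs z) _ id (cst z));
    [exact: cvg_id|exact: cvg_cst].
move=> /yz0; rewrite !near_simpl /=; apply: filterS => y.
rewrite /Q; case: (eqVneq y z) => [_ _|yz]; first by rewrite subrr normr0.
by rewrite subr_eq0 => /(_ yz); rewrite [_ *: 1]mulr1 subrK.
Qed.

Lemma slope_is_derive (K : numFieldType) (F Q : K -> K) (z : K) :
    {for z, continuous Q} -> (forall y, F y - F z = Q y * (y - z)) ->
  derivable F z 1 /\ derive1 F z = Q z.
Proof.
move=> Qc FQ.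
have FL : h^-1 *: (F (h *: 1 + z) - F z) @[h --> 0^'] --> Q z.
  have : Q (h + z) @[h --> (0 : K)^'] --> Q z.
    apply: cvg_within_filter.
    have : h + z @[h --> (0 : K)] --> z.
      by rewrite -[X in _ --> X]add0r;
        apply: (@cvgD K K K (nbhs (0 : K)) _ id (cst z));
        [exact: cvg_id|exact: cvg_cst].
    by move=> hz; exact: (@cvg_comp _ _ _ (fun h => h + z) Q _ _ _ hz Qc).
  apply: cvg_trans; apply: near_eq_cvg; near=> h.
  have h0 : h != 0 by near: h; exact: nbhs_dnbhs_neq.
  rewrite FQ [_ *: 1]mulr1 addrK; rewrite /GRing.scale /=.
  by rewrite mulrCA mulVf// mulr1.
split; first by apply/cvg_ex; exists (Q z).
by rewrite derive1E; apply: cvg_lim.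
Unshelve. all: by end_near. Qed.

(** F is differentiable over C while c is differentiable over R, so the slopes are combined by hand:
    that of the composite is the complex product of Q along c with u + i v, split into real and
    imaginary parts. *)
Lemma curve_deriv_comp (R : realType) (F : Cplx R -> Cplx R) (c : R -> Cplx R) (t : R) :
    {for t, continuous c} ->
    derivable (@cRe R \o c) t 1 -> derivable (@cIm R \o c) t 1 ->
    derivable F (c t) 1 ->
  curve_deriv (F \o c) t = derive1 F (c t) * curve_deriv c t.
Proof.
move=> cc /derivable_slope[u [uc uE uS]] /derivable_slope[v [vc vE vS]].
move=> /derivable_slope[Q [Qc QE QS]].
have Qct : {for t, continuous (Q \o c)} by exact: (continuous_comp cc Qc).
have Qre : {for t, continuous (@cRe R \o (Q \o c))}.
  by apply: continuous_comp => //; exact: cRe_continuous.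
have Qim : {for t, continuous (@cIm R \o (Q \o c))}.
  by apply: continuous_comp => //; exact: cIm_continuous.
have reE : derive1 (@cRe R \o (F \o c)) t =
    cRe (Q (c t)) * u t - cIm (Q (c t)) * v t.
  apply: (@slope_is_derive R _ (fun s => cRe (Q (c s)) * u s - cIm (Q (c s)) * v s) t _ _).2.
    by apply: cvgB; apply: cvgM.
  move=> s; rewrite mulrBl -!mulrA -uS -vS /= -raddfB /= QS.
  by rewrite /cRe /cIm -!raddfB; case: (Q _) => ? ?; case: (_ - _).
have imE : derive1 (@cIm R \o (F \o c)) t =
    cRe (Q (c t)) * v t + cIm (Q (c t)) * u t.
  apply: (@slope_is_derive R _ (fun s => cRe (Q (c s)) * v s + cIm (Q (c s)) * u s) t _ _).2.
    by apply: cvgD; apply: cvgM.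
  move=> s; rewrite mulrDl -!mulrA -uS -vS /= -raddfB /= QS.
  by rewrite /cRe /cIm -!raddfB; case: (Q _) => ? ?; case: (_ - _).
rewrite /curve_deriv reE imE -QE -uE -vE.
by case: (Q _).
Qed.

(** * Velocity vectors of curves in M *)

Lemma near_eq_curve_deriv (R : realType) (f g : R -> Cplx R) (t : R) :
  (\forall s \near t, f s = g s) -> curve_deriv f t = curve_deriv g t.
Proof.
move=> fg; rewrite /curve_deriv !derive1E; congr Complex;
  by apply: near_eq_derive; apply: filterS fg => s /= ->.
Qed.

Lemma near_chart (R : realType) (M : riemannSurface R) (c : R -> M) (t : R)
    (i : rs_index M) : {for t, continuous c} -> rs_dom i (c t) ->
  \forall s \near t, rs_dom i (c s).
Proof.
move=> cc ict; apply: cc; apply: open_nbhs_nbhs; split => //; exact: rs_dom_open.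
Qed.

(** The chain rule for the transition maps shows that the chart velocities form a tangent vector, so
    the [xget] in [velocity] does not fall back to 0. *)
Lemma velocityE (R : realType) (M : riemannSurface R) (c : R -> M) (t : R) :
    {for t, continuous c} ->
    (forall i, rs_dom i (c t) -> derivable (@cRe R \o (rs_phi i \o c)) t 1 /\
                                 derivable (@cIm R \o (rs_phi i \o c)) t 1) ->
  forall i, rs_dom i (c t) -> velocity c t i = curve_deriv (rs_phi i \o c) t.
Proof.
move=> cc dc; apply: (@xgetPex _ _ [set X : tangent (c t) | forall i, rs_dom i (c t) ->
            X i = curve_deriv (rs_phi i \o c) t]).
pose X i := if `[< rs_dom i (c t) >] then curve_deriv (rs_phi i \o c) t else 0.
have XE i : rs_dom i (c t) -> X i = curve_deriv (rs_phi i \o c) t.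
  by move=> ict; rewrite /X asboolT.
suff XP : X \in @tangent_pred R M (c t) by exists (Tangent XP) => i /XE.
apply/asboolP; split => [i ict|i j ict jct]; first by rewrite /X asboolF.
rewrite !XE// /trans_deriv.
(* Near t the curve stays in chart i, so it can be passed through [rs_phi i] and back. *)
transitivity (curve_deriv ((rs_phi j \o rs_psi i) \o (rs_phi i \o c)) t).
  by apply: near_eq_curve_deriv; apply: filterS (near_chart cc ict) => s /= /rs_phiK ->.
have [dre dim] := dc _ ict.
apply: curve_deriv_comp => //.
  by apply: continuous_comp => //; exact: rs_phi_cont.
by apply: rs_holo; exists (c t).
Qed.

Lemma near_eq_continuous (T U : topologicalType) (f g : T -> U) (x : T) :
  (\forall y \near x, f y = g y) -> {for x, continuous g} -> {for x, continuous f}.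
Proof.
move=> fg gc; rewrite /prop_for /continuous_at (nbhs_singleton fg).
by apply: cvg_trans gc; apply: near_eq_cvg; apply: filterS fg => y /= ->.
Qed.

(** In a chart the integrand is f(z) z' with f, z and z' continuous. *)
Lemma smooth_form_velocity_continuous (R : realType) (M : riemannSurface R)
    (alpha : form10 M) (D : set R) (c : R -> M) (t : R) :
    smooth_form alpha -> open D -> smooth_curve D c -> D t ->
  {for t, continuous (fun s => cRe (alpha (c s) (velocity c s)))} /\
  {for t, continuous (fun s => cIm (alpha (c s) (velocity c s)))}.
Proof.
move=> salpha oD sc Dt; have [cc dc] := sc t Dt.
have [i ict] := rs_cover (c t).
have [f sf alphaE] := salpha i.
pose z := rs_phi i \o c.
pose u := derive1 (@cRe R \o z); pose v := derive1 (@cIm R \o z).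
have near_alpha : \forall s \near t, alpha (c s) (velocity c s) = f (z s) * Complex (u s) (v s).
  have nD : \forall s \near t, D s by apply: open_nbhs_nbhs.
  apply: filterS2 nD (near_chart cc ict) => s Ds ics.
  have [ccs dcs] := sc s Ds.
  by rewrite (alphaE _ _ ics) velocityE// => j /dcs - /(_ 0%N).
have zc : {for t, continuous z} by apply: continuous_comp => //; exact: rs_phi_cont.
have [fre fim] := sf 0%N.
have zt : (rs_phi i @` rs_dom i) (z t) by exists (c t).
have frec : {for t, continuous ((@cRe R \o f) \o z)}.
  by apply: (@continuous_comp _ _ _ z (@cRe R \o f)); [exact: zc|exact: (fre _ zt)].
have fimc : {for t, continuous ((@cIm R \o f) \o z)}.
  by apply: (@continuous_comp _ _ _ z (@cIm R \o f)); [exact: zc|exact: (fim _ zt)].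
(* Order 1 of the smoothness of c: the first derivatives are themselves derivable, hence
   continuous. *)
have [/derivable1_diffP/differentiable_continuous uc
      /derivable1_diffP/differentiable_continuous vc] := dc i 1%N ict.
split.
  apply: (@near_eq_continuous _ _ _ (fun s => cRe (f (z s)) * u s - cIm (f (z s)) * v s)).
    by apply: filterS near_alpha => s ->; case: (f _).
  by apply: cvgB; apply: cvgM.
apply: (@near_eq_continuous _ _ _ (fun s => cRe (f (z s)) * v s + cIm (f (z s)) * u s)).
  by apply: filterS near_alpha => s ->; case: (f _).
by apply: cvgD; apply: cvgM.
Qed.

(** * Integrability of a smooth form along a loop *)

(** The restriction of f to the union is the sum of its restrictions to A and to B minus A; removing
    A from B keeps the overlap from counting twice. *)
Lemma integrable_setU d (T : measurableType d) (R : realType)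
    (mu : {measure set T -> \bar R}) (A B : set T) (f : T -> \bar R) :
    measurable A -> measurable B ->
  mu.-integrable A f -> mu.-integrable B f -> mu.-integrable (A `|` B) f.
Proof.
move=> mA mB iA iB; have mBA := measurableD mB mA.
have {iB}iBA : mu.-integrable (B `\` A) f by apply: (integrableS mB) => // x [].
apply/integrable_mkcond; first exact: measurableU.
have /integrable_mkcond iA' := iA; have /integrable_mkcond iBA' := iBA.
have := integrableD measurableT (iA' mA) (iBA' mBA).
apply: eq_integrable => // x _ /=.
rewrite !patchE in_setU in_setD.
by case: (x \in A); case: (x \in B); rewrite /= ?adde0 ?add0e.
Qed.

Lemma integrable_set1 (R : realType) (a : R) (f : R -> \bar R) :
  lebesgue_measure.-integrable [set a] f.
Proof.
by apply/integrableP; split; [exact: measurable_fun_set1|rewrite integral_set1].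
Qed.

(** The integrand of the smooth extension h is continuous on the compact interval. That of c agrees
    with it only inside, since c may have corners at a and b. *)
Lemma smooth_arc_integrable (R : realType) (M : riemannSurface R)
    (alpha : form10 M) (a b : R) (c : R -> M) :
    smooth_form alpha -> a < b -> smooth_arc a b c ->
  lebesgue_measure.-integrable `]a, b]
     (EFin \o (fun t => cRe (alpha (c t) (velocity c t)))) /\
  lebesgue_measure.-integrable `]a, b]
     (EFin \o (fun t => cIm (alpha (c t) (velocity c t)))).
Proof.
move=> salpha ab [h [e [e0 sh hc]]].
have sub t : t \in `[a, b] -> t \in `]a - e, b + e[.
  by rewrite !in_itv /= => /andP[? ?]; apply/andP; split; lra.
have hcont t (tab : t \in `[a, b]) :=
  smooth_form_velocity_continuous salpha (itv_open _ _) sh (sub t tab).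
(* The two velocities have different types, [tangent (h t)] and [tangent (c t)], so they are
   compared through their coordinates in a common chart. *)
have agree t : t \in `]a, b[ ->
    alpha (h t) (velocity h t) = alpha (c t) (velocity c t).
  move=> tab; have tab' : t \in `[a, b] by apply: subset_itv_oo_cc tab.
  have [hct dht] := sh t (sub t tab').
  have hcn : \forall s \near t, c s = h s.
    by apply: filterS (near_in_itvoo tab) => s sab; rewrite hc//; exact: subset_itv_oo_cc sab.
  have cht := nbhs_singleton hcn.
  have cct : {for t, continuous c} by apply: near_eq_continuous hcn hct.
  have [i ict] := rs_cover (c t).
  have iht : rs_dom i (h t) by rewrite -cht.
  have [f _ alphaE] := salpha i.
  rewrite !alphaE//.
  have zE j : \forall s \near t, (rs_phi j \o c) s = (rs_phi j \o h) s.
    by apply: filterS hcn => s /= ->.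
  rewrite (velocityE cct _ ict); last first.
    move=> j; rewrite cht => /dht - /(_ 0%N) [dre dim].
    split; [apply: near_eq_derivable dre|apply: near_eq_derivable dim];
      by apply: filterS (zE j) => s /= ->.
  rewrite (velocityE hct _ iht); last by move=> j /dht - /(_ 0%N).
  rewrite cht; congr (_ * _); apply: near_eq_curve_deriv.
  by apply: filterS (zE i) => s /= ->.
have half (r : Cplx R -> R) :
    (forall t, t \in `[a, b] ->
      {for t, continuous (fun s => r (alpha (h s) (velocity h s)))}) ->
  lebesgue_measure.-integrable `]a, b]
     (EFin \o (fun t => r (alpha (c t) (velocity c t)))).
  move=> rc.
  have icc : lebesgue_measure.-integrable `[a, b]
      (EFin \o (fun t => r (alpha (h t) (velocity h t)))).
    apply: continuous_compact_integrable; first exact: segment_compact.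
    by apply: continuous_in_subspaceT => t; rewrite inE => /rc.
  (* The end point b, where c may have no velocity, is split off as a null set. *)
  rewrite -(@setUitv1 _ _ (BRight a) b true) ?bnd_simp//.
  apply: integrable_setU => //; last exact: integrable_set1.
  have ioo : lebesgue_measure.-integrable `]a, b[
      (EFin \o (fun t => r (alpha (h t) (velocity h t)))).
    by apply: integrableS icc => //; exact: subset_itv_oo_cc.
  apply: eq_integrable ioo => // t; rewrite inE => tab.
  by rewrite /= agree.
by split; apply: half => t /hcont [].
Qed.

Lemma loop_integrable (R : realType) (M : riemannSurface R)
    (alpha : form10 M) (c : pw_smooth_loop M) : smooth_form alpha ->
  lebesgue_measure.-integrable `[0, 1]
     (EFin \o (fun t => cRe (alpha (c t) (velocity c t)))) /\
  lebesgue_measure.-integrable `[0, 1]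
     (EFin \o (fun t => cIm (alpha (c t) (velocity c t)))).
Proof.
move=> salpha.
(* The starting point is kept general for the induction on the subdivision. *)
have pieces a s : path <%R a s ->
    (forall k, (k < size s)%N -> smooth_arc (nth 0 (a :: s) k) (nth 0 s k) c) ->
  [/\ a <= last a s, lebesgue_measure.-integrable `]a, last a s]
     (EFin \o (fun t => cRe (alpha (c t) (velocity c t)))) &
  lebesgue_measure.-integrable `]a, last a s]
     (EFin \o (fun t => cIm (alpha (c t) (velocity c t))))].
  elim: s a => [|b s IH] a /=.
    by move=> _ _; rewrite set_itvoc0; split => //; exact: integrable_set0.
  move=> /andP[ab ps] sc.
  have [bl ire iim] := IH b ps (fun k => sc k.+1).
  have [jre jim] := smooth_arc_integrable salpha ab (sc 0%N isT).
  split; first exact: le_trans (ltW ab) bl.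
    rewrite (@itv_bndbnd_setU _ _ _ (BRight b)) ?bnd_simp ?(ltW ab)//.
    exact: integrable_setU.
  rewrite (@itv_bndbnd_setU _ _ _ (BRight b)) ?bnd_simp ?(ltW ab)//.
  exact: integrable_setU.
have [s [ps <- sc]] := loop_pieces c; have [le01 ire iim] := pieces 0 s ps sc.
(* The half-open pieces miss only the point 0, which is a null set. *)
by rewrite -(@setU1itv _ _ _ 0 false) ?bnd_simp//; split; apply: integrable_setU => //;
  exact: integrable_set1.
Qed.

(** * Periods of u^2, v^2 and uv *)

Lemma purely_imaginaryP (R : realType) (z : Cplx R) : purely_imaginary z <-> cRe z = 0.
Proof.
split=> [[y ->]|]; first by rewrite /cRe /=; ring.
case: z => a b /= ->; exists b; apply/eqP.
by rewrite eq_complex /=; apply/andP; split; apply/eqP; ring.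
Qed.

Lemma Rintegral_lincomb d (T : measurableType d) (R : realType)
    (mu : {measure set T -> \bar R}) (A : set T) (f g : T -> R) (a b : R) :
    measurable A -> mu.-integrable A (EFin \o f) -> mu.-integrable A (EFin \o g) ->
  \int[mu]_(x in A) (a * f x + b * g x) =
  a * \int[mu]_(x in A) f x + b * \int[mu]_(x in A) g x.
Proof.
move=> mA fi gi.
have Zi k h : mu.-integrable A (EFin \o h) ->
    mu.-integrable A (EFin \o (fun x => k * h x)).
  by move=> hi; apply: eq_integrable (integrableZl mA k hi).
by rewrite RintegralD ?RintegralZl//; exact: Zi.
Qed.

Lemma half_ofReal (R : realType) : 2^-1 = ofReal (2^-1) :> Cplx R.
Proof. by rewrite -[RHS]/(((2^-1 : R)%:C)%C) fmorphV rmorph_nat. Qed.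

Lemma conjE (R : realType) (z : Cplx R) : z^* = Complex (cRe z) (- cIm z).
Proof. by case: z. Qed.

Lemma period_uu (R : realType) (M : riemannSurface R) (w : weierstrass M)
    (c : pw_smooth_loop M) :
  period c (spinor_prod (spinor_u w) (spinor_u w)) =
    2^-1 * (period c (w 0) - imagU R * period c (w 1)).
Proof.
have [r0 i0] := loop_integrable c (wform_smooth w 0).
have [r1 i1] := loop_integrable c (wform_smooth w 1).
(* Multiplication by -i sends a + i b to b - i a, which accounts for the exchanged parts and the
   signs in the terms of [w 1]. *)
transitivity (Complex (2^-1 * cRe (period c (w 0)) + 2^-1 * cIm (period c (w 1)))
            (2^-1 * cIm (period c (w 0)) + (- 2^-1) * cRe (period c (w 1)))).
  rewrite [LHS]/period; congr Complex; rewrite /= -Rintegral_lincomb//;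
    apply: eq_Rintegral => t _; rewrite spinor_uuE half_ofReal;
    by case: (w 0 _ _) => ? ?; case: (w 1 _ _) => ? ? /=; rewrite /cRe /cIm /=; ring.
rewrite half_ofReal; case: (period c (w 0)) => ? ?; case: (period c (w 1)) => ? ?.
by apply/eqP; rewrite eq_complex /cRe /cIm /=; apply/andP; split; apply/eqP; ring.
Qed.

Lemma period_vv (R : realType) (M : riemannSurface R) (w : weierstrass M)
    (c : pw_smooth_loop M) :
  period c (spinor_prod (spinor_v w) (spinor_v w)) =
    - 2^-1 * (period c (w 0) + imagU R * period c (w 1)).
Proof.
have [r0 i0] := loop_integrable c (wform_smooth w 0).
have [r1 i1] := loop_integrable c (wform_smooth w 1).
transitivity (Complex ((- 2^-1) * cRe (period c (w 0)) + 2^-1 * cIm (period c (w 1)))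
            ((- 2^-1) * cIm (period c (w 0)) + (- 2^-1) * cRe (period c (w 1)))).
  rewrite [LHS]/period; congr Complex; rewrite /= -Rintegral_lincomb//;
    apply: eq_Rintegral => t _; rewrite spinor_vvE half_ofReal;
    by case: (w 0 _ _) => ? ?; case: (w 1 _ _) => ? ? /=; rewrite /cRe /cIm /=; ring.
rewrite half_ofReal; case: (period c (w 0)) => ? ?; case: (period c (w 1)) => ? ?.
by apply/eqP; rewrite eq_complex /cRe /cIm /=; apply/andP; split; apply/eqP; ring.
Qed.

Lemma period_uv (R : realType) (M : riemannSurface R) (w : weierstrass M)
    (c : pw_smooth_loop M) :
  period c (spinor_prod (spinor_u w) (spinor_v w)) = 2^-1 * period c (w 2).
Proof.
have [r2 i2] := loop_integrable c (wform_smooth w 2).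
transitivity (Complex (2^-1 * cRe (period c (w 2))) (2^-1 * cIm (period c (w 2)))).
  rewrite [LHS]/period; congr Complex; rewrite /= -RintegralZl//;
  apply: eq_Rintegral => t _; rewrite spinor_uvE half_ofReal;
  by case: (w 2 _ _) => ? ? /=; rewrite /cRe /cIm /=; ring.
rewrite half_ofReal; case: (period c (w 2)) => ? ?.
by apply/eqP; rewrite eq_complex /cRe /cIm /=; apply/andP; split; apply/eqP; ring.
Qed.

Theorem proposition38 (R : realType) (M : riemannSurface R) (w : weierstrass M) :
  (forall (c : pw_smooth_loop M) (k : 'I_3), purely_imaginary (period c (w k)))
  <->
  (forall c : pw_smooth_loop M,
     (period c (spinor_prod (spinor_u w) (spinor_u w)))^*
       = period c (spinor_prod (spinor_v w) (spinor_v w))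
     /\ purely_imaginary (period c (spinor_prod (spinor_u w) (spinor_v w)))).
Proof.
(* The equivalence holds for each loop separately. *)
suff loopwise c : (forall k : 'I_3, purely_imaginary (period c (w k))) <->
     (period c (spinor_prod (spinor_u w) (spinor_u w)))^*
       = period c (spinor_prod (spinor_v w) (spinor_v w))
     /\ purely_imaginary (period c (spinor_prod (spinor_u w) (spinor_v w))).
  by split=> H c; apply/loopwise/H.
rewrite period_uu period_vv period_uv purely_imaginaryP half_ofReal conjE.
transitivity [/\ cRe (period c (w 0)) = 0, cRe (period c (w 1)) = 0
  & cRe (period c (w 2)) = 0].
  split=> [H|[H0 H1 H2] k]; first by split; apply/purely_imaginaryP.
  apply/purely_imaginaryP.
  have : k \in [:: 0; 1; 2] by case: k => -[|[|[|]]].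
  by rewrite !inE => /or3P[] /eqP ->.
case: (period c (w 0)) => a0 b0; case: (period c (w 1)) => a1 b1.
case: (period c (w 2)) => a2 b2; rewrite /cRe /cIm /=.
split=> [[-> -> ->]|[[re im] uv]].
  by split; [apply/eqP; rewrite eq_complex /=; apply/andP; split; apply/eqP|]; ring.
(* Up to a factor 1/2, [re] says a0 + b1 = - a0 + b1 and [im] says a1 - b0 = - a1 - b0: the
   imaginary parts cancel, leaving a0 = a1 = 0, while [uv] gives a2 = 0. *)
split; lra.
Qed.
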